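(* In the noisy setting, there is a sequence $\epsilon_n\to0$ such that for all $n$ \[ P^*_{\mathrm{error}}\ge 2(1-\epsilon_n)\left\{\beta\wedge\frac1{I(Y;\tilde Y)}\right\}\frac{\log n}{n}. \]
   Context: Setting. Let $\mathcal X,\mathcal Y$ be finite alphabets; logarithms are to base $|\mathcal X|$. Let $\mathbf X=\{X_i\}_{i\in\mathbb Z}$ be a random process on $\mathcal X$. Fix $\beta>0$; let $\ell=\ell(n)=\beta\log n$ (rounded to an integer) and $n_\ell:=n-(2\ell-1)$. Let $I(1)\sim\mathrm{Uniform}[n]$ and, conditionally on $I(1)$, let $I(2)$ be uniform on $I(1)+\{-\ell+1,\dots,n-\ell\}$ if $1\le I(1)\le \ell-1$, uniform on $[n]$ if $\ell\le I(1)\le n-\ell+1$, and uniform on $I(1)+\{\ell-n,\dots,\ell-1\}$ if $n-\ell+2\le I(1)\le n$; $(I(1),I(2))$ is independent of $\mathbf X$. Noiseless reads: $X_1^\ell(j):=X_{I(j)}^{I(j)+\ell-1}$, $j=1,2$. Signed overlap: $T:=\max\{0,\ell-(I(2)-I(1))\}$ if $I(2)\ge I(1)$, $T:=-\max\{0,\ell-(I(1)-I(2))\}$ if $I(2)<I(1)$, with values in $\mathcal T:=\{-(\ell-1),\dots,0,\dots,\ell\}$, $\mathbb P[T=0]=n_\ell/n$, $\mathbb P[T=t]=1/n$ for $t\ne0$. Noisy reads $Y_1^\ell(j)\in\mathcal Y^\ell$ are drawn from a kernel $P_{Y_1^\ell\mid X_1^\ell}$ given $X_1^\ell(j)$, conditionally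 independently given the noiseless reads. A detector is any map $\hat T:\mathcal Y^\ell\times\mathcal Y^\ell\to\mathcal T$; $P_{\mathrm{error}}(\hat T):=\mathbb P[\hat T(Y_1^\ell(1),Y_1^\ell(2))\ne T]$, $P^*_{\mathrm{error}}:=\min_{\hat T}P_{\mathrm{error}}(\hat T)$. Noisy setting: $\mathbf X$ is i.i.d. with marginal $P_X$, and $P_{Y_1^\ell\mid X_1^\ell}(y_1^\ell\mid x_1^\ell)=\prod_{i=1}^\ell P_{Y\mid X}(y_i\mid x_i)$. $P_Y$ is the $Y$-marginal of $P_X\otimes P_{Y\mid X}$, $P_{Y\tilde Y}(y,\tilde y):=\sum_xP_X(x)P_{Y\mid X}(y\mid x)P_{Y\mid X}(\tilde y\mid x)$, and $I(Y;\tilde Y)$ is the mutual information under $P_{Y\tilde Y}$ (with $1/0=\infty$). *)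

(* Defs.v *)
From HB Require Import structures.
From mathcomp Require Import all_boot all_order all_algebra.
From mathcomp Require Import all_classical all_reals all_analysis.

Unset Strict Implicit.
Unset Printing Implicit Defensive.

Import Order.TTheory GRing.Theory Num.Theory.
Local Open Scope ring_scope.

Section OverlapDetection.
Variables (R : realType) (X Y : finType).

Definition logX (x : R) : R := ln x / ln (#|X|%:R).

(* read length ell = beta log n, rounded to the nearest integer *)
Definition ell (beta : R) (n : nat) : nat := Num.truncn (beta * logX n%:R + 2^-1).

Definition zrange (a b : int) : seq int :=
  if a <= b then [seq a + (k%:Z) | k <- iota 0 (absz (b - a)).+1] else [::].

(* support of I(2) given I(1) = i1 (I(2) is uniform on it; it always has n points) *)
Definition I2supp (n l : nat) (i1 : int) : seq int :=
  if (1 <= i1) && (i1 <= l%:Z - 1) then zrange (i1 - l%:Z + 1) (i1 + n%:Z - l%:Z)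
  else if (l%:Z <= i1) && (i1 <= n%:Z - l%:Z + 1) then zrange 1 n%:Z
  else zrange (i1 + l%:Z - n%:Z) (i1 + l%:Z - 1).

(* signed overlap T as a function of d = I(2) - I(1) *)
Definition Tval (l : nat) (d : int) : int :=
  if 0 <= d then Num.max 0 (l%:Z - d) else - Num.max 0 (l%:Z + d).

(* the set T = {-(l-1), ..., l} is indexed by 'I_(2l): k |-> k - (l-1) *)
Definition tOf (l : nat) (k : 'I_(2 * l)) : int := k%:Z - (l%:Z - 1).

Definition readsAt (L l : nat) (z : {ffun 'I_L -> X}) (s : nat) (x : {ffun 'I_l -> X}) : bool :=
  [forall k : 'I_l, forall j : 'I_L, (nat_of_ord j == s + k)%N ==> (z j == x k)].

(* joint law of the noiseless reads (X_{I1}^{I1+l-1}, X_{I1+d}^{I1+d+l-1}) for the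
   i.i.d. process with marginal PX: marginal of the product law on the window
   of positions min(I1,I1+d), ..., max(I1,I1+d)+l-1 (length l + |d|). *)
Definition PXpair (PX : X -> R) (l : nat) (d : int) (x1 x2 : {ffun 'I_l -> X}) : R :=
  let s1 := if 0 <= d then 0%N else absz d in
  let s2 := if 0 <= d then absz d else 0%N in
  \sum_(z : {ffun 'I_(l + absz d) -> X})
     (\prod_(j : 'I_(l + absz d)) PX (z j)) * (readsAt (l + absz d) l z s1 x1)%:R * (readsAt (l + absz d) l z s2 x2)%:R.

Definition chan (W : X -> Y -> R) (l : nat) (x : {ffun 'I_l -> X}) (y : {ffun 'I_l -> Y}) : R :=
  \prod_(k : 'I_l) W (x k) (y k).

Definition Qpair (PX : X -> R) (W : X -> Y -> R) (l : nat) (d : int)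
    (y1 y2 : {ffun 'I_l -> Y}) : R :=
  \sum_(x1 : {ffun 'I_l -> X}) \sum_(x2 : {ffun 'I_l -> X})
     PXpair PX l d x1 x2 * chan W l x1 y1 * chan W l x2 y2.

Definition Detector (l : nat) := {ffun {ffun 'I_l -> Y} * {ffun 'I_l -> Y} -> 'I_(2 * l)}.

(* P_error(That): I(1) uniform on [n], I(2) uniform on I2supp given I(1) *)
Definition Perr (PX : X -> R) (W : X -> Y -> R) (n l : nat) (f : Detector l) : R :=
  \sum_(i1 <- iota 1 n) \sum_(i2 <- I2supp n l i1%:Z)
    (n%:R^-1 * n%:R^-1) *
    \sum_(y : {ffun 'I_l -> Y} * {ffun 'I_l -> Y})
       Qpair PX W l (i2 - i1%:Z) y.1 y.2 * (tOf l (f y) != Tval l (i2 - i1%:Z))%:R.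

Definition Pstar (PX : X -> R) (W : X -> Y -> R) (n l : nat) : R :=
  \big[Num.min/1]_(f : Detector l) Perr PX W n l f.

Definition PY (PX : X -> R) (W : X -> Y -> R) (y : Y) : R := \sum_(x : X) PX x * W x y.

Definition PYY (PX : X -> R) (W : X -> Y -> R) (y y' : Y) : R :=
  \sum_(x : X) PX x * W x y * W x y'.

(* I(Y; Ytilde), base |X|, with 0 log 0 = 0 *)
Definition MI (PX : X -> R) (W : X -> Y -> R) : R :=
  \sum_(y : Y) \sum_(y' : Y)
    (if PYY PX W y y' == 0 then 0
     else PYY PX W y y' * logX (PYY PX W y y' / (PY PX W y * PY PX W y'))).

(* beta /\ 1/I(Y;Ytilde), with 1/0 = +infinity *)
Definition betaMinInvI (PX : X -> R) (W : X -> Y -> R) (beta : R) : R :=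
  if MI PX W == 0 then beta else Num.min beta (MI PX W)^-1.

End OverlapDetection.

(* Main.v *)
Require Import Defs.
From HB Require Import structures.
From mathcomp Require Import all_boot all_order all_algebra.
From mathcomp Require Import all_classical all_reals all_analysis.
From mathcomp Require Import ring lra zify.
Import Order.TTheory GRing.Theory Num.Theory.
Import numFieldNormedType.Exports.
Local Open Scope ring_scope.

Set Implicit Arguments.
Unset Strict Implicit.
Unset Printing Implicit Defensive.

(** Change of measure.  Let [q] be the probability that a detector declares a nonzero
    overlap when the reads are independent.  On the event that the information density
    of the [k] overlapping symbols is at most [(1 - delta) ln n], the law of the reads
    is at most [n^(1 - delta)] times the independent law; as
    long as [k I(Y; Y~)] is below [(1 - 2 delta) ln n], a Chernoff bound makes the
    complement of this event negligible.  Hence detecting all overlaps [t] with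
    [|t| <= m], [m] close to [{beta /\ 1/I(Y; Y~)} log n], has total success probability
    at most [o(m) + n^(1 - delta) q], whereas false alarms cost about [n q] on the same
    scale (each nonzero overlap having prior [1/n]).  So at least [(2 m / n)(1 - o(1))]
    is lost in every case. *)

(** * Law of two noisy reads at a given displacement *)

Section PairLaw.
Variables (R : realType) (X Y : finType) (PX : X -> R) (W : X -> Y -> R).

Let PY := PY R X Y PX W.
Let PYY := PYY R X Y PX W.
Let Qpair := Qpair R X Y PX W.

Definition symbol_at {A : Type} {l : nat} (y : {ffun 'I_l -> A}) (k : nat) : option A :=
  omap y (insub k).

(** The defaults encode missing symbols: a position outside the read contributes the neutral factor
    1, and a symbol of the second read without a partner keeps its marginal law. *)
Definition PY_opt (b : option Y) : R := oapp PY 1 b.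
Definition kernel_opt (K : Y -> Y -> R) (a : option Y) (b : Y) : R :=
  oapp (K^~ b) (PY b) a.

(* Reads at distance [d]: symbol [k] of the second read is emitted from the same input
   as symbol [d + k] of the first one, when there is one; [K] is the law of such a pair. *)
Definition pair_law (K : Y -> Y -> R) (l d : nat) (y1 y2 : {ffun 'I_l -> Y}) : R :=
  (\prod_(0 <= j < d) PY_opt (symbol_at y1 j)) *
  \prod_(k < l) kernel_opt K (symbol_at y1 (d + k)) (y2 k).

Lemma symbol_at_ord {A : Type} l (y : {ffun 'I_l -> A}) (k : 'I_l) :
  symbol_at y k = Some (y k).
Proof. by rewrite /symbol_at valK. Qed.

Lemma symbol_at_ge {A : Type} l (y : {ffun 'I_l -> A}) k :
  (l <= k)%N -> symbol_at y k = None.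
Proof. by move=> lk; rewrite /symbol_at insubN // -leqNgt. Qed.

Lemma prod_symbol_at {A : Type} (F : nat -> option A -> R) l (y : {ffun 'I_l -> A}) n :
  (forall j, F j None = 1) -> (l <= n)%N ->
  \prod_(0 <= j < n) F j (symbol_at y j) = \prod_(j < l) F j (Some (y j)).
Proof.
move=> F0 ln; rewrite (@big_cat_nat _ _ _ l) //= [X in _ * X]big1_seq ?mulr1.
  by rewrite big_mkord; apply: eq_bigr => j _; rewrite symbol_at_ord.
by move=> j /andP[_]; rewrite mem_index_iota => /andP[lj _]; rewrite symbol_at_ge.
Qed.

Lemma big_nat_shift (T : Type) (idx : T) (op : T -> T -> T) (F : nat -> T) d l :
  \big[op/idx]_(d <= j < d + l) F j = \big[op/idx]_(k < l) F (d + k)%N.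
Proof.
rewrite -{1}[d]add0n big_addn addKn big_mkord.
by apply: eq_bigr => k _; rewrite addnC.
Qed.

Definition subread {A : Type} {L l s : nat} (sL : (s + l <= L)%N)
    (z : {ffun 'I_L -> A}) : {ffun 'I_l -> A} :=
  [ffun k : 'I_l => z (Ordinal (leq_trans
     (eq_ind_r is_true (ltn_ord k) (ltn_add2l s k l)) sL))].

Lemma readsAtE L l s (sL : (s + l <= L)%N) (z : {ffun 'I_L -> X}) (x : {ffun 'I_l -> X}) :
  readsAt X L l z s x = (x == subread sL z).
Proof.
apply/idP/eqP => [/forallP rx | ->].
  apply/ffunP => k; rewrite ffunE; set j := Ordinal _.
  by have /forallP/(_ j) := rx k; rewrite eqxx => /eqP.
apply/forallP => k; apply/forallP => j; apply/implyP => /eqP jE.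
by rewrite ffunE; apply/eqP; congr (z _); apply: val_inj.
Qed.

Lemma sum_readsAt L l s (sL : (s + l <= L)%N) (z : {ffun 'I_L -> X})
    (F : {ffun 'I_l -> X} -> R) :
  \sum_x (readsAt X L l z s x)%:R * F x = F (subread sL z).
Proof.
rewrite (bigD1 (subread sL z)) //= readsAtE eqxx mul1r big1 ?addr0 // => x nx.
by rewrite readsAtE (negbTE nx) mul0r.
Qed.

(** Each indicator [readsAt] selects the one noiseless read cut out of the window [z], so the sums
    over [x1] and [x2] collapse. *)
Lemma window_sum L l s1 s2 (y1 y2 : {ffun 'I_l -> Y})
  (s1L : (s1 + l <= L)%N) (s2L : (s2 + l <= L)%N) :
  \sum_(x1 : {ffun 'I_l -> X}) \sum_(x2 : {ffun 'I_l -> X})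
    (\sum_(z : {ffun 'I_L -> X}) (\prod_(j : 'I_L) PX (z j)) *
       (readsAt X L l z s1 x1)%:R * (readsAt X L l z s2 x2)%:R) *
    chan R X Y W l x1 y1 * chan R X Y W l x2 y2 =
  \sum_(z : {ffun 'I_L -> X}) (\prod_(j : 'I_L) PX (z j)) *
    chan R X Y W l (subread s1L z) y1 * chan R X Y W l (subread s2L z) y2.
Proof.
under eq_bigr => x1 _.
  under eq_bigr => x2 _ do rewrite 2!mulr_suml.
  rewrite exchange_big /=; over.
rewrite exchange_big /=; apply: eq_bigr => z _.
rewrite -mulrA -(sum_readsAt s1L z (fun x => chan R X Y W l x y1 * _)) mulr_sumr.
apply: eq_bigr => x1 _.
rewrite -(sum_readsAt s2L z (fun x => chan R X Y W l x y2)) !mulr_sumr.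
by apply: eq_bigr => x2 _; ring.
Qed.

Definition chan_at (s l : nat) (y : {ffun 'I_l -> Y}) (j : nat) (x : X) : R :=
  if (s <= j)%N then oapp (W x) 1 (symbol_at y (j - s)) else 1.

Lemma symbol_at_subread {A : Type} L l s (sL : (s + l <= L)%N)
    (z : {ffun 'I_L -> A}) (k : 'I_l) :
  symbol_at z (s + k) = Some (subread sL z k).
Proof. by rewrite ffunE -symbol_at_ord. Qed.

Lemma chan_subread L l s (sL : (s + l <= L)%N) (z : {ffun 'I_L -> X})
    (y : {ffun 'I_l -> Y}) :
  chan R X Y W l (subread sL z) y = \prod_(j < L) chan_at s y j (z j).
Proof.
pose f j := oapp (chan_at s y j) 1 (symbol_at z j).
transitivity (\prod_(0 <= j < L) f j); last first.
  by rewrite big_mkord; apply: eq_bigr => j _; rewrite /f symbol_at_ord.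
have f1 i : (i < s)%N || (s + l <= i)%N -> f i = 1.
  rewrite /f /chan_at; case: (symbol_at z i) => //= x.
  case: leqP => //= si sli.
  by rewrite symbol_at_ge // leq_subRL.
rewrite (@big_cat_nat _ _ _ s) //=; last by rewrite (leq_trans _ sL) // leq_addr.
rewrite big1_seq ?mul1r => [|j /andP[_]]; last first.
  by rewrite mem_index_iota => /andP[_ js]; rewrite f1 ?js.
rewrite (@big_cat_nat _ _ _ (s + l)) ?leq_addr //= [X in _ * X]big1_seq ?mulr1.
  rewrite big_nat_shift; apply: eq_bigr => k _.
  by rewrite /f (symbol_at_subread sL) /= /chan_at leq_addr addKn symbol_at_ord.
by move=> j /andP[_]; rewrite mem_index_iota => /andP[lj _]; rewrite f1 ?lj ?orbT.
Qed.

Hypothesis PX1 : \sum_x PX x = 1.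

Lemma window_prod L l s1 s2 (y1 y2 : {ffun 'I_l -> Y})
  (s1L : (s1 + l <= L)%N) (s2L : (s2 + l <= L)%N) :
  \sum_(z : {ffun 'I_L -> X}) (\prod_(j : 'I_L) PX (z j)) *
    chan R X Y W l (subread s1L z) y1 * chan R X Y W l (subread s2L z) y2 =
  \prod_(j < L) \sum_x PX x * chan_at s1 y1 j x * chan_at s2 y2 j x.
Proof.
rewrite bigA_distr_bigA /=; apply: eq_bigr => z _.
by rewrite !chan_subread !big_split.
Qed.

(** The window is cut at [d]. Earlier positions are seen by the first read at most, and those seen
    by neither read (when [d > l]) sum to 1. Position [d + k] emits symbol [k] of the second read,
    paired with the first read while [d + k < l]. *)
Lemma window_pair_law l d (y1 y2 : {ffun 'I_l -> Y}) :
  \prod_(j < l + d) \sum_x PX x * chan_at 0 y1 j x * chan_at d y2 j x =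
  pair_law PYY d y1 y2.
Proof.
rewrite -(big_mkord xpredT (fun j => \sum_x PX x * chan_at 0 y1 j x * chan_at d y2 j x)).
rewrite (@big_cat_nat _ _ _ d) ?leq_addl //=; congr (_ * _).
  rewrite !big_nat; apply: eq_bigr => j /= jd.
  rewrite /chan_at [(d <= j)%N]leqNgt jd leq0n subn0 /PY_opt /=.
  under eq_bigr do rewrite mulr1.
  by case: (symbol_at y1 j) => //=; under eq_bigr do rewrite mulr1.
rewrite [(l + d)%N]addnC big_nat_shift; apply: eq_bigr => k _.
rewrite /chan_at leq_addr addKn symbol_at_ord /= subn0 /kernel_opt.
case: (symbol_at y1 _) => //=.
by under eq_bigr do rewrite mulr1.
Qed.

Lemma Qpair_pos l (d : nat) (y1 y2 : {ffun 'I_l -> Y}) :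
  Qpair d%:Z y1 y2 = pair_law PYY d y1 y2.
Proof.
rewrite -window_pair_law /Qpair /Defs.Qpair /PXpair /=.
have s1 : (0 + l <= l + d)%N by rewrite leq_addr.
have s2 : (d + l <= l + d)%N by rewrite addnC.
by rewrite (window_sum y1 y2 s1 s2) window_prod.
Qed.

Lemma Qpair_neg l (d : nat) (y1 y2 : {ffun 'I_l -> Y}) :
  Qpair (- d%:Z) y1 y2 = pair_law PYY d y2 y1.
Proof.
(* Displacement zero falls into the nonnegative branch of the definition, where the reads are not
   exchanged; there the two channel factors commute. *)
case: d => [|d]; first rewrite oppr0.
  have s1 : (0 + l <= l + 0)%N by rewrite leq_addr.
  rewrite -window_pair_law /Qpair /Defs.Qpair /PXpair /= (window_sum y1 y2 s1 s1).
  by rewrite window_prod; apply: eq_bigr => j _; apply: eq_bigr => x _; rewrite mulrAC.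
rewrite -window_pair_law /Qpair /Defs.Qpair /PXpair oppr_ge0 /=.
have s1 : (0 + l <= l + d.+1)%N by rewrite leq_addr.
have s2 : (d.+1 + l <= l + d.+1)%N by rewrite addnC.
rewrite (window_sum y1 y2 s2 s1) window_prod.
by apply: eq_bigr => j _; apply: eq_bigr => x _; rewrite mulrAC.
Qed.

End PairLaw.

(** * Change of measure to independent reads *)

Section ChangeOfMeasure.
Variables (R : realType) (X Y : finType) (PX : X -> R) (W : X -> Y -> R).
Hypothesis PX_ge0 : forall x, 0 <= PX x.
Hypothesis PX1 : \sum_x PX x = 1.
Hypothesis W_ge0 : forall x y, 0 <= W x y.
Hypothesis W1 : forall x, \sum_y W x y = 1.

Let PY := PY R X Y PX W.
Let PYY := PYY R X Y PX W.
Let pair_law := @pair_law R X Y PX W.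

Definition info (a b : Y) : R := ln (PYY a b / (PY a * PY b)).

Lemma PY_ge0 a : 0 <= PY a.
Proof. by apply: sumr_ge0 => x _; rewrite mulr_ge0. Qed.

Lemma PYY_ge0 a b : 0 <= PYY a b.
Proof. by apply: sumr_ge0 => x _; rewrite !mulr_ge0. Qed.

Lemma PY_sum1 : \sum_a PY a = 1.
Proof.
rewrite exchange_big /= -[RHS]PX1; apply: eq_bigr => x _.
by rewrite -mulr_sumr W1 mulr1.
Qed.

Lemma PYYC a b : PYY a b = PYY b a.
Proof. by apply: eq_bigr => x _; rewrite mulrAC. Qed.

Lemma PYY_marginal a : \sum_b PYY a b = PY a.
Proof.
by rewrite exchange_big /=; apply: eq_bigr => x _; rewrite -mulr_sumr W1 mulr1.
Qed.

Lemma PYY_sum1 : \sum_a \sum_b PYY a b = 1.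
Proof. by rewrite -PY_sum1; apply: eq_bigr => a _; rewrite PYY_marginal. Qed.

Lemma PYY_le_PY a b : PYY a b <= PY a.
Proof.
rewrite -PYY_marginal (bigD1 b) //= lerDl.
by apply: sumr_ge0 => b' _; apply: PYY_ge0.
Qed.

(** Equality holds where [PYY] is positive, because both marginals are then positive too. Where
    [PYY] vanishes, [info] is [ln 0 = 0], and only the inequality survives. *)
Lemma PYY_info a b : PYY a b <= PY a * PY b * expR (info a b).
Proof.
have [->|nz] := eqVneq (PYY a b) 0.
  by rewrite !mulr_ge0 ?PY_ge0 ?expR_ge0.
have pos : 0 < PYY a b by rewrite lt0r nz PYY_ge0.
have pa : 0 < PY a by apply: lt_le_trans pos (PYY_le_PY _ _).
have pb : 0 < PY b by apply: lt_le_trans pos _; rewrite PYYC PYY_le_PY.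
rewrite /info lnK ?posrE ?divr_gt0 ?mulr_gt0 // mulrC divfK //.
by rewrite mulf_neq0 ?gt_eqF.
Qed.

Lemma pair_law_ge0 (K : Y -> Y -> R) l d (y1 y2 : {ffun 'I_l -> Y}) :
  (forall a b, 0 <= K a b) -> 0 <= pair_law K d y1 y2.
Proof.
move=> K0; rewrite mulr_ge0 ?prodr_ge0 // => j _.
  by rewrite /PY_opt; case: (symbol_at _ _) => //= a; apply: PY_ge0.
by rewrite /kernel_opt; case: (symbol_at _ _) => [a|] //=; apply: PY_ge0.
Qed.

Lemma pair_law_le (K K' : Y -> Y -> R) l d (y1 y2 : {ffun 'I_l -> Y}) :
  (forall a b, 0 <= K a b <= K' a b) -> pair_law K d y1 y2 <= pair_law K' d y1 y2.
Proof.
move=> KK'; apply: ler_wpM2l.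
  rewrite prodr_ge0 // => j _.
  by rewrite /PY_opt; case: (symbol_at _ _) => //= a; apply: PY_ge0.
apply: ler_prod => k _; rewrite /kernel_opt.
by case: (symbol_at _ _) => [a|] //=; rewrite ?lexx ?andbT; apply: PY_ge0.
Qed.

Definition indep_law l (y1 y2 : {ffun 'I_l -> Y}) : R :=
  (\prod_(k < l) PY (y1 k)) * \prod_(k < l) PY (y2 k).

Lemma indep_law_ge0 l (y1 y2 : {ffun 'I_l -> Y}) : 0 <= indep_law y1 y2.
Proof. by rewrite mulr_ge0 ?prodr_ge0 // => j _; apply: PY_ge0. Qed.

Lemma pair_law_far (K : Y -> Y -> R) l d (y1 y2 : {ffun 'I_l -> Y}) :
  (l <= d)%N -> pair_law K d y1 y2 = indep_law y1 y2.
Proof.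
move=> ld; congr (_ * _).
  exact: (prod_symbol_at y1 (F := fun=> @PY_opt R X Y PX W)).
apply: eq_bigr => k _; rewrite symbol_at_ge //.
by rewrite (leq_trans ld) ?leq_addr.
Qed.

Lemma pair_law_indep l d (y1 y2 : {ffun 'I_l -> Y}) :
  pair_law (fun a b => PY a * PY b) d y1 y2 = indep_law y1 y2.
Proof.
rewrite /indep_law -(prod_symbol_at y1 (F := fun=> @PY_opt R X Y PX W) (n := d + l)) ?leq_addl //.
rewrite [in RHS](@big_cat_nat _ _ _ d) ?leq_addr //= -mulrA; congr (_ * _).
rewrite big_nat_shift -big_split /=.
apply: eq_bigr => k _; rewrite /kernel_opt /PY_opt.
by case: (symbol_at _ _) => //=; rewrite mul1r.
Qed.

(** Unpaired symbols sum to 1, and each of the [l - d] overlapping pairs contributes the total mass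
    of [K]. As [K] need not be normalised, this covers both the law of the reads and its exponential
    tilts. *)
Lemma sum_pair_law (K : Y -> Y -> R) l d : (d <= l)%N ->
  \sum_(y1 : {ffun 'I_l -> Y}) \sum_(y2 : {ffun 'I_l -> Y}) pair_law K d y1 y2 =
  (\sum_a \sum_b K a b) ^+ (l - d).
Proof.
(* [G j] is the factor left at position [j] of the first read once the second read is summed out. *)
move=> dl; pose G j o := if (j < d)%N then @PY_opt R X Y PX W o
  else oapp (fun a => \sum_b K a b) 1 o.
transitivity (\sum_(y1 : {ffun 'I_l -> Y}) \prod_(j < l) G j (Some (y1 j))).
  apply: eq_bigr => y1 _; rewrite -mulr_sumr.
  rewrite -(bigA_distr_bigA (fun k : 'I_l => @kernel_opt R X Y PX W K (symbol_at y1 (d + k)))).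
  rewrite -(@prod_symbol_at _ _ G l y1 (d + l)) ?leq_addl //; last first.
    by move=> j; rewrite /G; case: ifP.
  rewrite [in RHS](@big_cat_nat _ _ _ d) ?leq_addr //=; congr (_ * _).
    by rewrite !big_nat; apply: eq_bigr => j /= jd; rewrite /G jd.
  rewrite big_nat_shift; apply: eq_bigr => k _.
  rewrite /G ltnNge leq_addr /= /kernel_opt.
  by case: (symbol_at _ _) => //=; apply: PY_sum1.
rewrite -(bigA_distr_bigA (fun (j : 'I_l) a => G j (Some a))) /=.
rewrite -(big_mkord xpredT (fun j => \sum_a G j (Some a))).
rewrite (@big_cat_nat _ _ _ d) //= big_nat big1 ?mul1r => [|j /= jd]; last first.
  by rewrite /G jd; apply: PY_sum1.
rewrite -prodr_const_nat big_nat [RHS]big_nat; apply: eq_bigr => j /andP[dj _].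
by rewrite /G ltnNge dj.
Qed.

Definition info_sum l d (y1 y2 : {ffun 'I_l -> Y}) : R :=
  \sum_(k < l) oapp (info^~ (y2 k)) 0 (symbol_at y1 (d + k)).

Lemma pair_law_tilt (K : Y -> Y -> R) (s : R) l d (y1 y2 : {ffun 'I_l -> Y}) :
  pair_law (fun a b => K a b * expR (s * info a b)) d y1 y2 =
  pair_law K d y1 y2 * expR (s * info_sum d y1 y2).
Proof.
rewrite /info_sum mulr_sumr expR_sum -mulrA -big_split /=; congr (_ * _).
apply: eq_bigr => k _; rewrite /kernel_opt.
by case: (symbol_at _ _) => //=; rewrite mulr0 expR0 mulr1.
Qed.

(* Either the information density is at most [v], and the likelihood ratio is at
   most [expR v], or it exceeds [v], and the exponential is at least [1]. *)
Lemma pair_law_split (s v : R) l d (y1 y2 : {ffun 'I_l -> Y}) : 0 <= s ->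
  pair_law PYY d y1 y2 <= expR v * indep_law y1 y2 +
    pair_law (fun a b => PYY a b * expR (s * info a b)) d y1 y2 * expR (- (s * v)).
Proof.
move=> s0; have Q0 := pair_law_ge0 d y1 y2 PYY_ge0.
have I0 := indep_law_ge0 y1 y2.
rewrite pair_law_tilt -mulrA -expRD -mulrBr.
have [vS|Sv] := leP v (info_sum d y1 y2).
  apply: ler_wpDl; first by rewrite mulr_ge0 ?expR_ge0.
  by rewrite ler_peMr // -expR0 ler_expR mulr_ge0 // subr_ge0.
apply: ler_wpDr; first by rewrite mulr_ge0 ?expR_ge0.
(* The product kernel tilted with parameter 1 dominates [PYY], and its pair law is the independent
   law times the exponential of [info_sum]. *)
apply: (@le_trans _ _ (pair_law (fun a b => PY a * PY b * expR (1 * info a b)) d y1 y2)).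
  by apply: pair_law_le => a b; rewrite PYY_ge0 mul1r PYY_info.
rewrite pair_law_tilt pair_law_indep mul1r mulrC ler_wpM2r //.
by rewrite ler_expR ltW.
Qed.

End ChangeOfMeasure.

(** * Counting overlaps and displacements *)

Lemma sum_eq_le1 (R : numDomainType) (I : finType) (T : eqType) (h : I -> T) (t : T) :
  injective h -> \sum_i (t == h i)%:R <= 1 :> R.
Proof.
move=> hI; case: (pickP [pred i | t == h i]) => [i /= /eqP ->|no].
  rewrite (bigD1 i) //= eqxx big1 ?addr0 // => j ji.
  by rewrite (inj_eq hI) eq_sym (negbTE ji).
by rewrite big1 ?ler01 // => i _; have /= -> := no i.
Qed.

(** The values [-1, ..., -m] and [m, ..., 1] are distinct and nonzero. They are listed in the order
    in which they occur as the displacement grows. *)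
Lemma sum_overlaps_le (R : numDomainType) (m : nat) (t : int) :
  \sum_(j < m) (t == - (j.+1)%:Z)%:R + \sum_(j < m) (t == (m - j)%N%:Z)%:R
    <= (t != 0)%:R :> R.
Proof.
have neg0 : 0 <= t -> \sum_(j < m) (t == - (j.+1)%:Z)%:R = 0 :> R.
  by move=> t0; apply: big1 => j _; case: eqP => //; lia.
have pos0 : t <= 0 -> \sum_(j < m) (t == (m - j)%N%:Z)%:R = 0 :> R.
  by move=> t0; apply: big1 => j _; case: eqP => //; have := ltn_ord j; lia.
have [t0|t0|t0] := ltgtP t 0 => /=.
- rewrite pos0 ?addr0 ?(ltW t0) //; apply: (sum_eq_le1 R (h := fun j : 'I_m => - j.+1%:Z)) => i j /eqP.
  by rewrite eqr_opp => /eqP [] /val_inj.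
- rewrite neg0 ?add0r ?(ltW t0) //; apply: (sum_eq_le1 R (h := fun j : 'I_m => (m - j)%N%:Z)) => i j [] ij.
  by apply: val_inj => /=; have := ltn_ord i; have := ltn_ord j; lia.
- by rewrite neg0 ?pos0 ?addr0 ?t0.
Qed.

(** In all three cases the support is a run of [n] integers starting [A] places before [i1]. The two
    bounds on [A] say that it contains every displacement of absolute value below [l], so boundary
    positions of the first read behave like interior ones. *)
Lemma I2supp_window (n l i1 : nat) : (0 < l)%N -> (2 * l <= n)%N -> (1 <= i1 <= n)%N ->
  exists A : nat, [/\ (l <= A.+1)%N, (A + l <= n)%N &
    I2supp n l i1%:Z = [seq i1%:Z - A%:Z + k%:Z | k <- iota 0 n]].
Proof.
move=> l0 ln /andP[i1_ge i1_le].
have zrangeE (A : nat) (b : int) : b = i1%:Z - A%:Z + n%:Z - 1 ->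
    zrange (i1%:Z - A%:Z) b = [seq i1%:Z - A%:Z + k%:Z | k <- iota 0 n].
  move=> ->; rewrite /zrange ifT; last by lia.
  by congr (map _ (iota _ _)); lia.
rewrite /I2supp; case: ifP => c1.
  exists l.-1; split; [lia|lia|].
  by rewrite -(@zrangeE l.-1 (i1%:Z + n%:Z - l%:Z)) //; [congr zrange|]; lia.
case: ifP => c2.
  exists i1.-1; split; [lia|lia|].
  by rewrite -(@zrangeE i1.-1 n%:Z) //; [congr zrange|]; lia.
exists (n - l)%N; split; [lia|lia|].
by rewrite -(@zrangeE (n - l)%N (i1%:Z + l%:Z - 1)) //; [congr zrange|]; lia.
Qed.

(** The displacements are cut into five runs: far left, [m] smallest negative overlaps, middle, [m]
    smallest positive overlaps, far right. The far runs have [n - 2 * l + 1] elements together,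
    whatever [A] is; the middle run is dropped. *)
Lemma sum_window_ge (R : numDomainType) (g : int -> R) (q : R) (n l m A : nat) :
  (m < l)%N -> (l <= A.+1)%N -> (A + l <= n)%N -> (2 * l <= n)%N ->
  (forall d, 0 <= g d) -> (forall d : int, (l <= absz d)%N -> g d = q) ->
  (n - 2 * l).+1%:R * q + (\sum_(j < m) g (j.+1%:Z - l%:Z) +
    \sum_(j < m) g (l%:Z - (m - j)%N%:Z)) <= \sum_(0 <= k < n) g (k%:Z - A%:Z).
Proof.
move=> ml lA An ln g0 gq.
have drop0 a b : 0 <= \sum_(a <= k < b) g (k%:Z - A%:Z) by exact: sumr_ge0.
rewrite (@big_cat_nat _ _ _ (A.+1 - l)) /=; [|lia..].
rewrite (@big_cat_nat _ _ _ (A.+1 - l + m) (A.+1 - l)) /=; [|lia..].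
rewrite (@big_cat_nat _ _ _ (A + l - m) (A.+1 - l + m)) /=; [|lia..].
rewrite (@big_cat_nat _ _ _ (A + l) (A + l - m)) /=; [|lia..].
have far a b : (b <= A.+1 - l)%N || (A + l <= a)%N ->
    \sum_(a <= k < b) g (k%:Z - A%:Z) = (b - a)%:R * q.
  move=> ab; rewrite mulr_natl -sumr_const_nat big_nat [RHS]big_nat.
  by apply: eq_bigr => k kab; apply: gq; lia.
rewrite [X in _ <= X + _]far ?leqnn // [X in _ <= _ + (_ + (_ + (_ + X)))]far ?leqnn ?orbT //.
have near a b : b = (a + m)%N -> \sum_(a <= k < b) g (k%:Z - A%:Z) =
    \sum_(j < m) g ((a + j)%:Z - A%:Z) by move=> ->; rewrite big_nat_shift.
rewrite (near (A.+1 - l)%N) // (near (A + l - m)%N (A + l)%N); last by lia.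
have -> : (n - 2 * l).+1 = (A.+1 - l + (n - (A + l)))%N by lia.
rewrite natrD mulrDl subn0.
have -> : \sum_(j < m) g ((A.+1 - l + j)%:Z - A%:Z) =
    \sum_(j < m) g (j.+1%:Z - l%:Z) by apply: eq_bigr => j _; congr g; lia.
have -> : \sum_(j < m) g ((A + l - m + j)%:Z - A%:Z) =
    \sum_(j < m) g (l%:Z - (m - j)%N%:Z).
  by apply: eq_bigr => j _; congr g; have := ltn_ord j; lia.
set mid := \sum_(_ <= _ < _) _.
have mid0 : 0 <= mid by exact: drop0.
rewrite -subr_ge0; apply: le_trans mid0 _; rewrite le_eqVlt; apply/orP; left; apply/eqP.
by ring.
Qed.

(** * Error probability of a fixed detector *)

Section ErrorBound.
Variables (R : realType) (X Y : finType) (PX : X -> R) (W : X -> Y -> R).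
Hypothesis PX_ge0 : forall x, 0 <= PX x.
Hypothesis PX1 : \sum_x PX x = 1.
Hypothesis W_ge0 : forall x y, 0 <= W x y.
Hypothesis W1 : forall x, \sum_y W x y = 1.

Let PYY := PYY R X Y PX W.
Let Qpair := Qpair R X Y PX W.

Definition mgf (s : R) : R := \sum_a \sum_b PYY a b * expR (s * info PX W a b).

Lemma Qpair_signed l (d : int) (y1 y2 : {ffun 'I_l -> Y}) :
  Qpair d y1 y2 = if 0 <= d then pair_law PX W PYY (absz d) y1 y2
                  else pair_law PX W PYY (absz d) y2 y1.
Proof.
case: d => d /=; first by rewrite -Qpair_pos.
by rewrite NegzE /Qpair Qpair_neg.
Qed.

Lemma Qpair_ge0 l (d : int) (y1 y2 : {ffun 'I_l -> Y}) : 0 <= Qpair d y1 y2.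
Proof.
by rewrite Qpair_signed; case: ifP => _;
  apply: (pair_law_ge0 PX_ge0 W_ge0) => a b; apply: PYY_ge0.
Qed.

Lemma Qpair_far l (d : int) (y1 y2 : {ffun 'I_l -> Y}) :
  (l <= absz d)%N -> Qpair d y1 y2 = indep_law PX W y1 y2.
Proof.
move=> ld; rewrite Qpair_signed !(pair_law_far _ _ _ _ _ ld).
by case: ifP => // _; rewrite /indep_law mulrC.
Qed.

Lemma sum_pair_law_signed (K : Y -> Y -> R) l (d : int) : (absz d <= l)%N ->
  \sum_(y : {ffun 'I_l -> Y} * {ffun 'I_l -> Y})
    (if 0 <= d then pair_law PX W K (absz d) y.1 y.2
     else pair_law PX W K (absz d) y.2 y.1) = (\sum_a \sum_b K a b) ^+ (l - absz d).
Proof.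
move=> dl; rewrite -(sum_pair_law PX1 W1 K dl).
by case: (0 <= d); last rewrite [RHS]exchange_big; rewrite pair_bigA.
Qed.

Lemma Qpair_sum1 l (d : int) : (absz d <= l)%N ->
  \sum_(y : {ffun 'I_l -> Y} * {ffun 'I_l -> Y}) Qpair d y.1 y.2 = 1.
Proof.
move=> dl; under eq_bigr do rewrite Qpair_signed.
by rewrite sum_pair_law_signed // PYY_sum1 // expr1n.
Qed.

(** This is [pair_law_split] summed over [E]; the exponential-moment term is then extended to all
    pairs of reads, where its sum is explicit. *)
Lemma Qpair_event l (d : int) (s v : R)
    (E : pred ({ffun 'I_l -> Y} * {ffun 'I_l -> Y})) : (absz d <= l)%N -> 0 <= s ->
  \sum_y Qpair d y.1 y.2 * (E y)%:R <=
  expR v * (\sum_y indep_law PX W y.1 y.2 * (E y)%:R) +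
  mgf s ^+ (l - absz d) * expR (- (s * v)).
Proof.
move=> dl s0; rewrite -(sum_pair_law_signed _ dl) mulr_sumr mulr_suml -big_split /=.
apply: ler_sum => y _.
have split y1 y2 := pair_law_split PX_ge0 W_ge0 W1 v (absz d) y1 y2 s0 (l := l).
have tilt0 y1 y2 : 0 <= pair_law PX W (fun a b => PYY a b * expR (s * info PX W a b))
    (absz d) y1 y2 * expR (- (s * v)) :> R.
  apply: mulr_ge0 (expR_ge0 _); apply: (pair_law_ge0 PX_ge0 W_ge0) => a b.
  by rewrite mulr_ge0 ?expR_ge0 ?PYY_ge0.
rewrite Qpair_signed; case: (E y); last first.
  by rewrite !mulr0 add0r; case: ifP => _; apply: tilt0.
rewrite !mulr1; case: ifP => _; first exact: split.
by rewrite [indep_law _ _ _ _]mulrC; apply: split.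
Qed.

Section Detector.
Variables (l : nat) (f : Detector Y l).

(** Non-overlapping reads follow the independent law, so the predicate [t != 0] gives the false
    alarm probability proper; singletons give its share for one declared overlap. *)
Definition false_alarm (P : pred int) : R :=
  \sum_(y : {ffun 'I_l -> Y} * {ffun 'I_l -> Y}) indep_law PX W y.1 y.2 * (P (tOf l (f y)))%:R.

Definition cond_err (d : int) : R :=
  \sum_(y : {ffun 'I_l -> Y} * {ffun 'I_l -> Y})
    Qpair d y.1 y.2 * (tOf l (f y) != Tval l d)%:R.

Lemma cond_err_ge0 d : 0 <= cond_err d.
Proof. by apply: sumr_ge0 => y _; rewrite mulr_ge0 ?Qpair_ge0. Qed.

Lemma cond_err_far (d : int) :
  (l <= absz d)%N -> cond_err d = false_alarm (fun t => t != 0).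
Proof.
move=> ld; apply: eq_bigr => y _; rewrite Qpair_far //.
suff -> : Tval l d = 0 by [].
by rewrite /Tval; case: ifP => d0; lia.
Qed.

Lemma cond_err_near (d : int) (s v : R) : (absz d <= l)%N -> 0 <= s ->
  1 - mgf s ^+ (l - absz d) * expR (- (s * v)) -
    expR v * false_alarm (pred1 (Tval l d)) <= cond_err d.
Proof.
move=> dl s0.
have := Qpair_event v (fun y => tOf l (f y) == Tval l d) dl s0.
have -> : cond_err d = 1 - \sum_y Qpair d y.1 y.2 * (tOf l (f y) == Tval l d)%:R.
  rewrite -[X in _ = X - _](Qpair_sum1 dl) -sumrB; apply: eq_bigr => y _.
  by case: (tOf _ _ == _); rewrite /= ?mulr0 ?mulr1 ?subr0 ?subrr.
rewrite /false_alarm /=; lra.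
Qed.

Lemma false_alarm_overlaps m :
  \sum_(j < m) false_alarm (pred1 (- j.+1%:Z)) +
  \sum_(j < m) false_alarm (pred1 (m - j)%N%:Z) <= false_alarm (fun t => t != 0).
Proof.
rewrite exchange_big /= [X in _ + X]exchange_big /= -big_split /=.
apply: ler_sum => y _; rewrite -!mulr_sumr -mulrDr.
by apply: ler_wpM2l (sum_overlaps_le _ _ _); apply: indep_law_ge0.
Qed.

(* Guessing an overlap of size at most [m] costs false alarms when the reads do not
   overlap, an event of much larger prior probability. *)
Lemma Perr_ge (n m : nat) (s v eta : R) :
  (m < l)%N -> (2 * l <= n)%N -> 0 <= s -> expR v <= (n - 2 * l).+1%:R ->
  (forall k, (k <= m)%N -> mgf s ^+ k * expR (- (s * v)) <= eta) ->
  2 * m%:R * (1 - eta) / n%:R <= Perr R X Y PX W n l f.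
Proof.
move=> ml ln s0 vn etaP.
have l0 : (0 < l)%N by case: l ml.
have n0 : 0 < n%:R :> R by rewrite ltr0n; lia.
(* One value of [I(1)], with both prior factors [n^-1] left out; adding [n] such rows leaves a
   single division by [n]. *)
have row (i1 : nat) : (1 <= i1 <= n)%N ->
    2 * m%:R * (1 - eta) <= \sum_(i2 <- I2supp n l i1%:Z) cond_err (i2 - i1%:Z).
  move=> i1n; have [A [lA An ->]] := I2supp_window l0 ln i1n.
  rewrite big_map (eq_bigr (fun k : nat => cond_err (k%:Z - A%:Z))); last first.
    by move=> k _; congr cond_err; lia.
  have := sum_window_ge ml lA An ln cond_err_ge0 cond_err_far.
  rewrite /index_iota subn0; apply: le_trans.
  have fa0 P : 0 <= false_alarm P.
    by apply: sumr_ge0 => y _; apply: mulr_ge0 => //; apply: indep_law_ge0.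
  have near (d t : int) : (l <= absz d + m)%N -> (absz d <= l)%N -> Tval l d = t ->
      1 - eta - expR v * false_alarm (pred1 t) <= cond_err d.
    move=> dm dl <-; apply: le_trans (cond_err_near v dl s0).
    by rewrite !lerD2r lerD2l lerN2 etaP //; lia.
  have s1 : \sum_(j < m) (1 - eta - expR v * false_alarm (pred1 (- j.+1%:Z))) <=
      \sum_(j < m) cond_err (j.+1%:Z - l%:Z).
    apply: ler_sum => j _; have jm := ltn_ord j.
    by apply: near; [lia|lia|rewrite /Tval; case: ifP; lia].
  have s2 : \sum_(j < m) (1 - eta - expR v * false_alarm (pred1 (m - j)%N%:Z)) <=
      \sum_(j < m) cond_err (l%:Z - (m - j)%N%:Z).
    apply: ler_sum => j _; have jm := ltn_ord j.
    by apply: near; [lia|lia|rewrite /Tval; case: ifP; lia].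
  rewrite !sumrB !sumr_const !card_ord -!mulr_sumr -!(mulr_natl eta) in s1 s2.
  (* What the detector gains on small overlaps is at most [expR v] times its total false alarm
     probability, and the far displacements already charge at least that much. *)
  have fam := ler_wpM2l (expR_ge0 v) (false_alarm_overlaps m).
  have := ler_wpM2r (fa0 (fun t => t != 0)) vn.
  by move: s1 s2 fam; rewrite mulrDr; lra.
have -> : Perr R X Y PX W n l f = \sum_(1 <= i1 < n.+1)
    (n%:R^-1 * n%:R^-1) * \sum_(i2 <- I2supp n l i1%:Z) cond_err (i2 - i1%:Z).
  by rewrite /index_iota subSS subn0; apply: eq_bigr => i1 _; rewrite mulr_sumr.
rewrite -mulr_sumr ler_pdivrMr // [leRHS]mulrAC -[_ * _ * n%:R]mulrA mulVf ?gt_eqF //.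
rewrite mulr1 [leRHS]mulrC ler_pdivlMr //.
apply: (@le_trans _ _ (\sum_(1 <= i1 < n.+1) (2 * m%:R * (1 - eta)))).
  by rewrite sumr_const_nat subSS subn0 -[leRHS]mulr_natr.
by rewrite big_nat [leRHS]big_nat; apply: ler_sum => i1 i1n; apply: row.
Qed.

End Detector.
End ErrorBound.

(** * Elementary bounds on the exponential *)

(** From [1 - x <= expR (- x)] one gets [expR x <= 1 / (1 - x)], and [(1 + x + 2 x^2)(1 - x) - 1 =
    x^2 (1 - 2 x)] is nonnegative here. *)
Lemma expR_le_quadratic (R : realType) (x : R) :
  x <= 2^-1 -> expR x <= 1 + x + 2 * x ^+ 2.
Proof.
move=> x2; have : 1 - x <= expR (- x) by apply: expR_ge1Dx.
rewrite expRN => h.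
have x1 : 0 < 1 - x by lra.
have e0 := expR_gt0 x.
have : expR x * (1 - x) <= 1 by rewrite -ler_pdivlMl ?mulr1.
rewrite -ler_pdivlMr // mul1r => /le_trans; apply.
rewrite -div1r ler_pdivrMr // -subr_ge0.
have -> : (1 + x + 2 * x ^+ 2) * (1 - x) - 1 = x ^+ 2 * (1 - 2 * x) by ring.
by rewrite mulr_ge0 ?sqr_ge0 //; lra.
Qed.

(** The factor [expR (delta * L)] is at least 2, so a second copy of [expR ((1 - delta) * L)] is
    available. It is at least [expR (L / 2) >= (1 + L / 4)^2], and [L^2 / 16 >= 2 b L]. With
    [L = ln n], the far displacements outnumber [n^(1 - delta)]. *)
Lemma expR_dominates (R : realType) (delta b L : R) :
  0 < delta -> delta <= 2^-1 -> 0 <= b -> 1 <= delta * L -> 32 * b <= L ->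
  expR ((1 - delta) * L) + (2 * b * L + 1) <= expR L.
Proof.
move=> d0 d2 b0 dL bL.
have L0 : 0 < L by rewrite -(pmulr_rgt0 _ d0); lra.
have -> : L = (1 - delta) * L + delta * L by ring.
rewrite [in leRHS]expRD -/(_ - _).
have -> : (1 - delta) * ((1 - delta) * L + delta * L) = (1 - delta) * L by ring.
have -> : (1 - delta) * L + delta * L = L by ring.
have two : 2 <= expR (delta * L) by apply: le_trans (expR_ge1Dx _); lra.
have half : expR (2^-1 * L) <= expR ((1 - delta) * L).
  by rewrite ler_expR ler_pM2r //; lra.
have quarter : 1 + 4^-1 * L <= expR (4^-1 * L) by apply: expR_ge1Dx.
have E : expR (2^-1 * L) = expR (4^-1 * L) * expR (4^-1 * L).
  by rewrite -expRD; congr expR; lra.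
have : (1 + 4^-1 * L) * (1 + 4^-1 * L) <= expR (2^-1 * L).
  by rewrite E; apply: ler_pM => //; lra.
have := ler_wpM2r (ltW L0) bL.
have := ler_wpM2l (expR_ge0 ((1 - delta) * L)) two.
nra.
Qed.

(** * Chernoff estimate for the information density *)

Section Asymptotics.
Variables (R : realType) (X Y : finType) (PX : X -> R) (W : X -> Y -> R).
Hypothesis PX_ge0 : forall x, 0 <= PX x.
Hypothesis PX1 : \sum_x PX x = 1.
Hypothesis W_ge0 : forall x y, 0 <= W x y.
Hypothesis W1 : forall x, \sum_y W x y = 1.

Let PYY := PYY R X Y PX W.

(** Mutual information in nats; pairs of probability zero vanish through their coefficient. *)
Definition nat_MI : R := \sum_a \sum_b PYY a b * info PX W a b.

Lemma nat_MIE : (1 < #|X|)%N -> nat_MI = MI R X Y PX W * ln #|X|%:R.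
Proof.
move=> X1; have c0 : ln (#|X|%:R : R) != 0 by rewrite gt_eqF // ln_gt0 // ltr1n.
rewrite mulr_suml; apply: eq_bigr => a _; rewrite mulr_suml; apply: eq_bigr => b _.
rewrite /info -/PYY; have [->|nz] := eqVneq (PYY a b) 0.
  by rewrite !mul0r.
by rewrite -mulrA /logX divfK.
Qed.

(** Averaging the quadratic bound on the exponential under [PYY] gives [1 + s I + 2 s^2 V]. [M]
    dominates every value of [info], which keeps the argument below one half; [V] is the second
    moment. *)
Lemma mgf_le : exists M V : R, [/\ 0 <= M, 0 <= V &
  forall s, 0 <= s -> s * M <= 2^-1 -> mgf PX W s <= expR (s * nat_MI + 2 * s ^+ 2 * V)].
Proof.
exists (\sum_a \sum_b `|info PX W a b|), (\sum_a \sum_b PYY a b * info PX W a b ^+ 2); split.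
- by apply: sumr_ge0 => a _; apply: sumr_ge0.
- apply: sumr_ge0 => a _; apply: sumr_ge0 => b _.
  by rewrite mulr_ge0 ?sqr_ge0 ?PYY_ge0.
move=> s s0 sM; apply: le_trans (expR_ge1Dx _).
rewrite -[X in _ <= X + _](PYY_sum1 PX1 W1) -/PYY /nat_MI !mulr_sumr -!big_split /=.
apply: ler_sum => a _; rewrite !mulr_sumr -!big_split /=.
apply: ler_sum => b _.
have -> : PYY a b + (s * (PYY a b * info PX W a b) + 2 * s ^+ 2 * (PYY a b * info PX W a b ^+ 2)) =
  PYY a b * (1 + s * info PX W a b + 2 * (s * info PX W a b) ^+ 2) by ring.
apply: ler_wpM2l; first exact: PYY_ge0.
apply: expR_le_quadratic; apply: le_trans sM; apply: ler_wpM2l => //.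
rewrite (bigD1 a) //= (bigD1 b) //= -addrA; apply: le_trans (ler_norm _) _.
rewrite lerDl addr_ge0 //; first exact: sumr_ge0.
by apply: sumr_ge0 => i _; apply: sumr_ge0.
Qed.

(* Chernoff bound: an overlap of size [k] with [k * nat_MI] below [(1 - 2 delta) L]
   is unlikely to produce an information density above [(1 - delta) L]. *)
Lemma mgf_tail (delta b : R) : 0 < delta -> 0 <= b -> exists2 s : R, 0 < s &
  forall (L : R) (k : nat), 0 <= L -> k%:R <= b * L ->
  k%:R * nat_MI <= (1 - 2 * delta) * L ->
  mgf PX W s ^+ k * expR (- (s * ((1 - delta) * L))) <= expR (- (s * delta / 2 * L)).
Proof.
move=> d0 b0; have [M [V [M0 V0 mgfP]]] := mgf_le.
have q0 : 0 <= V * b / delta by rewrite divr_ge0 ?mulr_ge0 // ltW.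
(* With [s = 1 / D], the first term of [D] ensures [s M <= 1/2], the second keeps the quadratic
   correction [2 s V b] below [delta / 2], and the last makes [D] positive. *)
pose D := 2 * M + 4 * (V * b / delta) + 1.
have D0 : 0 < D by rewrite /D; lra.
have s0 : 0 < D^-1 by rewrite invr_gt0.
exists D^-1 => // L k L0 kb kI.
have sM : D^-1 * M <= 2^-1 by rewrite ler_pdivrMl // /D; lra.
have sV : D^-1 * (2 * V * b) <= delta / 2.
  rewrite ler_pdivrMl //; have -> : 2 * V * b = 2 * delta * (V * b / delta).
    by field; rewrite gt_eqF.
  have : 0 <= M * delta by rewrite mulr_ge0 // ltW.
  rewrite /D; nra.
set s := D^-1 in s0 sM sV *.
have mgf0 : 0 <= mgf PX W s.
  apply: sumr_ge0 => a _; apply: sumr_ge0 => c _.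
  by rewrite mulr_ge0 ?expR_ge0 ?PYY_ge0.
apply: (@le_trans _ _ (expR (s * nat_MI + 2 * s ^+ 2 * V) ^+ k *
    expR (- (s * ((1 - delta) * L))))).
  apply: ler_wpM2r; first exact: expR_ge0.
  by apply: lerXn2r; rewrite ?nnegrE ?expR_ge0 //; apply: mgfP => //; apply: ltW.
rewrite -expRM_natl -expRD ler_expR.
have h1 := ler_wpM2l (ltW s0) kI.
have h2 : k%:R * (2 * s ^+ 2 * V) <= b * L * (2 * s ^+ 2 * V).
  by apply: ler_wpM2r => //; apply: mulr_ge0 => //; rewrite mulr_ge0 ?sqr_ge0.
have h3 := ler_wpM2l (mulr_ge0 (ltW s0) L0) sV.
nra.
Qed.

End Asymptotics.

(** * Lower bound with a fixed loss *)

Section LowerBound.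
Variables (R : realType) (X Y : finType) (PX : X -> R) (W : X -> Y -> R).
Hypothesis PX_ge0 : forall x, 0 <= PX x.
Hypothesis PX1 : \sum_x PX x = 1.
Hypothesis W_ge0 : forall x y, 0 <= W x y.
Hypothesis W1 : forall x, \sum_y W x y = 1.

(** Here [a] and [b] are the constants for natural logarithms. The bound by 1 is included because
    [Pstar] is a minimum with base value 1. *)
Lemma Perr_lower_nat (a b delta : R) : 0 < a -> a <= b -> a * nat_MI PX W <= 1 ->
  0 < delta -> delta <= 4^-1 ->
  exists L0 : R, forall n : nat, (0 < n)%N -> L0 <= ln n%:R ->
    let l := Num.truncn (b * ln n%:R + 2^-1) in
    2 * (1 - 4 * delta) * a * (ln n%:R / n%:R) <= 1 /\
    forall f : Detector Y l,
      2 * (1 - 4 * delta) * a * (ln n%:R / n%:R) <= Perr R X Y PX W n l f.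
Proof.
move=> a0 ab aI d0 d4; have b0 : 0 < b by apply: lt_le_trans ab.
have [s s0 tail] := mgf_tail PX_ge0 PX1 W_ge0 W1 d0 (ltW b0).
(* The summands serve in turn: rounding of [m] and [l], the two conditions of [expR_dominates], and
   a tail bound of at most [delta]. *)
exists ((delta * a)^-1 + delta^-1 + 32 * b + 2 / (s * delta ^+ 2)) => n n0.
have n0R : 0 < n%:R :> R by rewrite ltr0n.
have nE : expR (ln n%:R) = n%:R :> R by rewrite lnK.
move: nE; set L : R := ln n%:R => nE LL0 l.
have p1 : 0 < (delta * a)^-1 by rewrite invr_gt0 mulr_gt0.
have p2 : 0 < delta^-1 by rewrite invr_gt0.
have p3 : 0 < 2 / (s * delta ^+ 2) by rewrite divr_gt0 ?mulr_gt0 ?exprn_gt0.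
have L1 : 1 <= delta * a * L by rewrite -ler_pdivrMl ?mulr_gt0 // mulr1; lra.
have L2 : 1 <= delta * L by rewrite -ler_pdivrMl // mulr1; lra.
have L3 : 32 * b <= L by lra.
have L4 : delta^-1 <= s * delta / 2 * L.
  rewrite -ler_pdivrMl ?divr_gt0 ?mulr_gt0 //.
  have -> : (s * delta / 2)^-1 * delta^-1 = 2 / (s * delta ^+ 2).
    by field; rewrite !gt_eqF.
  lra.
have L0 : 0 < L by lra.
have aL0 : 0 < a * L by rewrite mulr_gt0.
have abL : a * L <= b * L by rewrite ler_pM2r.
have grow : expR ((1 - delta) * L) + (2 * b * L + 1) <= n%:R.
  by rewrite -nE; apply: expR_dominates => //; [lra|exact: ltW].
have e0 := expR_gt0 ((1 - delta) * L).
have err1 : 2 * (1 - 4 * delta) * a * (L / n%:R) <= 1.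
  rewrite mulrA ler_pdivrMr // mul1r.
  have : 0 <= delta * (a * L) by rewrite mulr_ge0 ?ltW.
  nra.
(* Rounding [m] costs at most [delta * a * L], leaving [1 - 3 delta]; the factor [1 - eta] with
   [eta = delta] then leaves at least [1 - 4 delta]. *)
split=> // f; pose m := Num.truncn ((1 - 2 * delta) * (a * L)).
have x0 : 0 <= (1 - 2 * delta) * (a * L) by rewrite mulr_ge0 ?(ltW aL0) //; lra.
have mle : m%:R <= (1 - 2 * delta) * (a * L) by rewrite truncn_le.
have mgt : (1 - 2 * delta) * (a * L) < m.+1%:R by apply: truncnS_gt.
have lle : l%:R <= b * L + 2^-1 by rewrite truncn_le //; nra.
have ml : (m < l)%N.
  rewrite truncn_ge_nat; last by nra.
  rewrite -natr1; nra.
have l2n : (2 * l <= n)%N by rewrite -(ler_nat R) natrM; nra.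
apply: le_trans (Perr_ge PX_ge0 PX1 W_ge0 W1 f (v := (1 - delta) * L)
  (eta := delta) ml l2n (ltW s0) _ _).
- rewrite mulrA ler_pM2r ?invr_gt0 //; rewrite -natr1 in mgt.
  have : (1 - 3 * delta) * (a * L) <= m%:R by nra.
  have d1 : 0 <= 1 - delta by lra.
  move=> /(ler_wpM2l d1).
  have : 0 <= delta ^+ 2 * (a * L) by rewrite mulr_ge0 ?sqr_ge0 ?ltW.
  nra.
- by rewrite -natr1 natrB // natrM; nra.
- move=> k km; have km' : k%:R <= m%:R :> R by rewrite ler_nat.
  apply: (@le_trans _ _ (expR (- (s * delta / 2 * L)))); last first.
    rewrite expRN -[leRHS]invrK lef_pV2 ?posrE ?expR_gt0 //.
    by apply: le_trans L4 _; apply: le_trans (expR_ge1Dx _); lra.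
  apply: tail; first exact: ltW.
    nra.
  (* Multiplying the bound on [k] by [nat_MI] requires a positive sign; otherwise the left side is
     already nonpositive. *)
  have [I0|I0] := leP (nat_MI PX W) 0.
    apply: (@le_trans _ _ 0); last by rewrite mulr_ge0 ?(ltW L0) //; lra.
    by rewrite mulr_ge0_le0.
  apply: (@le_trans _ _ ((1 - 2 * delta) * (a * L) * nat_MI PX W)).
    by rewrite ler_pM2r //; lra.
  rewrite -[leLHS]mulrA; apply: ler_wpM2l; first by lra.
  by rewrite mulrAC ler_piMl // ltW.
Qed.

Lemma le_bigmin_const (I : finType) (F : I -> R) (x : R) :
  x <= 1 -> (forall i, x <= F i) -> x <= \big[Num.min/1]_i F i.
Proof. by move=> x1 xF; elim/big_ind: _ => // u v xu xv; rewrite le_min xu. Qed.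

Lemma Pstar_ge0 n l : 0 <= Pstar R X Y PX W n l.
Proof.
apply: le_bigmin_const => // f; apply: sumr_ge0 => i1 _; apply: sumr_ge0 => i2 _.
rewrite mulr_ge0 ?mulr_ge0 ?invr_ge0 //; apply: sumr_ge0 => y _.
by rewrite mulr_ge0 ?(Qpair_ge0 PX_ge0 PX1 W_ge0).
Qed.

(** Dividing [B] and [beta] by [ln #|X|] passes from base [#|X|] to natural logarithms, and the
    bound then holds for every detector at once. *)
Lemma Pstar_lower (beta delta : R) : (1 < #|X|)%N ->
  0 < betaMinInvI R X Y PX W beta -> 0 < delta -> delta <= 4^-1 ->
  exists L0 : R, forall n : nat, (0 < n)%N -> L0 <= ln n%:R ->
    2 * (1 - 4 * delta) * betaMinInvI R X Y PX W beta * (logX R X n%:R / n%:R)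
      <= Pstar R X Y PX W n (ell R X beta n).
Proof.
move=> X1 B0 d0 d4; have c0 : 0 < ln (#|X|%:R : R) by rewrite ln_gt0 // ltr1n.
set B := betaMinInvI _ _ _ _ _ _ in B0 *.
have [Bb BI] : B <= beta /\ B * MI R X Y PX W <= 1.
  move: B0; rewrite /B /betaMinInvI; case: eqP => [->|_ B0].
    by rewrite mulr0.
  (* Since [B] is positive and at most the inverse of [MI], that inverse is positive. *)
  have MI0 : 0 < MI R X Y PX W.
    by rewrite -invr_gt0; apply: lt_le_trans B0 _; rewrite ge_min lexx orbT.
  by rewrite -ler_pdivlMr // mul1r !ge_min !lexx orbT.
have aI : B / ln #|X|%:R * nat_MI PX W <= 1.
  by rewrite nat_MIE // mulrACA mulVf ?gt_eqF // mulr1.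
have ab : B / ln #|X|%:R <= beta / ln #|X|%:R by rewrite ler_pM2r ?invr_gt0.
have [L0 main] := Perr_lower_nat (divr_gt0 B0 c0) ab aI d0 d4.
exists L0 => n n0 nL; have /= := main n n0 nL.
have -> : 2 * (1 - 4 * delta) * (B / ln #|X|%:R) * (ln n%:R / n%:R) =
    2 * (1 - 4 * delta) * B * (logX R X n%:R / n%:R) by rewrite /logX; ring.
have -> : Num.truncn (beta / ln #|X|%:R * ln n%:R + 2^-1) = ell R X beta n.
  by rewrite /ell /logX; congr Num.truncn; ring.
by move=> [le1 lef]; apply: le_bigmin_const.
Qed.
End LowerBound.

(** * The vanishing sequence *)

Local Open Scope classical_set_scope.

Theorem mainTheorem4 (R : realType) (X Y : finType) (PX : X -> R) (W : X -> Y -> R)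
    (beta : R) :
  (1 < #|X|)%N ->
  (forall x, 0 <= PX x) -> \sum_(x : X) PX x = 1 ->
  (forall x y, 0 <= W x y) -> (forall x, \sum_(y : Y) W x y = 1) ->
  0 < beta ->
  exists eps : nat -> R, eps @ \oo --> 0 /\
    forall n : nat,
      2 * (1 - eps n) * betaMinInvI R X Y PX W beta * (logX R X n%:R / n%:R)
        <= Pstar R X Y PX W n (ell R X beta n).
Proof.
move=> X1 PX_ge0 PX1 W_ge0 W1 beta0.
have c0 : 0 < ln (#|X|%:R : R) by rewrite ln_gt0 // ltr1n.
set B := betaMinInvI R X Y PX W beta; pose P n := Pstar R X Y PX W n (ell R X beta n).
have P0 n : 0 <= P n by apply: Pstar_ge0.
have rate0 n : 0 <= logX R X n%:R / n%:R :> R.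
  rewrite divr_ge0 // divr_ge0 ?(ltW c0) //; case: n => [|n]; first by rewrite ln0.
  by rewrite ln_ge0 // ler1n.
(* [B <= 0] is impossible, as mutual information is nonnegative, but the bound is
   trivial in that case anyway. *)
have [B0|Bpos] := leP B 0.
  exists (fun=> 0); split; first exact: cvg_cst.
  move=> n; apply: le_trans (P0 n).
  by rewrite mulr_le0_ge0 // subr0 mulr1 mulr_ge0_le0.
pose rate n : R := 2 * B * (logX R X n%:R / n%:R).
have rateE n e : 2 * (1 - e) * B * (logX R X n%:R / n%:R) = (1 - e) * rate n.
  by rewrite /rate; ring.
(* For positive [rate n] this is the least nonnegative value satisfying the bound; when [rate n] is
   zero, as for [n <= 1], the bound is just [P n >= 0]. *)
exists (fun n => Num.max 0 (1 - P n / rate n)); split; last first.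
  move=> n; rewrite rateE; have : 0 <= rate n by rewrite mulr_ge0 // mulr_ge0 // ltW.
  rewrite le_eqVlt => /orP[/eqP <-|rate_gt0]; first by rewrite mulr0 P0.
  rewrite -ler_pdivlMr // lerBlDr -lerBlDl.
  by rewrite le_max lexx orbT.
apply/cvgrPdist_le => e e0.
(* The loss [4 * delta] is then at most [e]. *)
pose delta := Num.min (e / 4) 4^-1.
have d0 : 0 < delta by rewrite lt_min divr_gt0 //= invr_gt0.
have d4 : delta <= 4^-1 by rewrite ge_min lexx orbT.
have de : delta <= e / 4 by rewrite ge_min lexx.
have [L0 lower] := Pstar_lower PX_ge0 PX1 W_ge0 W1 X1 Bpos d0 d4.
near=> n.
have n1 : (1 < n)%N by near: n; exact: nbhs_infty_gt.
have nL : expR L0 <= n%:R by near: n; exact: nbhs_infty_ger.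
have n0 : 0 < n%:R :> R by rewrite ltr0n ltnW.
have rate_gt0 : 0 < rate n.
  by rewrite !mulr_gt0 ?invr_gt0 // ln_gt0 // ltr1n.
rewrite sub0r normrN ger0_norm ?le_max ?lexx // ge_max (ltW e0) /=.
have := lower n (ltnW n1); rewrite -ler_expR lnK // => /(_ nL).
rewrite rateE -ler_pdivlMr // -/(P n); lra.
Unshelve. all: by end_near.
Qed.
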